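(* Let $m\ge 2$ be even and $n\ge 2$. Let $c=(c_1,\dots,c_n)^T,\ d=(d_1,\dots,d_n)^T\in\mathbb{R}^n$ with $d_i\neq 0$ for all $i\in[n]$, and assume $c_{i_1}+\cdots+c_{i_m}\neq 0$ for all $i_1,\dots,i_m\in[n]$. Let $\mathcal{C}$ be the generalized Cauchy tensor of order $m$ and dimension $n$ with generating vectors $c,d$. Then the following are equivalent: (i) $\mathcal{C}$ is a completely decomposable tensor; (ii) $\mathcal{C}$ is an SOS tensor; (iii) $\mathcal{C}$ is positive semi-definite; (iv) $c_i>0$ for all $i\in[n]$.
   Context: $[n]=\{1,\dots,n\}$. For a real order-$m$ dimension-$n$ tensor $\mathcal{A}=(a_{i_1\cdots i_m})$ and $x\in\mathbb{R}^n$, $\mathcal{A}x^m=\sum_{i_1,\dots,i_m=1}^n a_{i_1\cdots i_m}x_{i_1}\cdots x_{i_m}$. The generalized Cauchy tensor with generating vectors $c,d\in\mathbb{R}^n$ is $\mathcal{C}=(c_{i_1\cdots i_m})$ with $c_{i_1\cdots i_m}=\frac{d_{i_1}d_{i_2}\cdots d_{i_m}}{c_{i_1}+c_{i_2}+\cdots+c_{i_m}}$. A tensor $\mathcal{A}$ (of even order $m$) is positive semi-definite if $\mathcal{A}x^m\ge 0$ for all $x\in\mathbb{R}^n$. A symmetric tensor $\mathcal{A}$ of even order $m=2k$ is an SOS tensor if the polynomial $x\mapsto\mathcal{A}x^m$ is a sum of squares of polynomials of degree $k$. $\mathcal{A}$ is completely decomposable if there exist vectors $x_1,\dots,x_r\in\mathbb{R}^n$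 with $\mathcal{A}=\sum_{j=1}^r x_j^{m}$, where $x^m$ denotes the rank-one tensor with entries $x_{i_1}x_{i_2}\cdots x_{i_m}$. *)

(* Defs.v *)
From HB Require Import structures.
From mathcomp Require Import all_boot all_order all_algebra all_fingroup.
Set Implicit Arguments. Unset Strict Implicit. Unset Printing Implicit Defensive.
Import Order.TTheory GRing.Theory Num.Theory.
Local Open Scope ring_scope.

Definition tensor (R : Type) (m n : nat) := {ffun 'I_m -> 'I_n} -> R.

Definition tapp (R : rcfType) (m n : nat) (A : tensor R m n) (x : 'I_n -> R) : R :=
  \sum_(idx : {ffun 'I_m -> 'I_n}) A idx * \prod_(k < m) x (idx k).

Definition cauchy_tensor (R : rcfType) (m n : nat) (c d : 'I_n -> R) : tensor R m n :=
  fun idx => (\prod_(k < m) d (idx k)) / (\sum_(k < m) c (idx k)).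

Definition psd_tensor (R : rcfType) (m n : nat) (A : tensor R m n) : Prop :=
  forall x : 'I_n -> R, 0 <= tapp A x.

Definition symmetric_tensor (R : rcfType) (m n : nat) (A : tensor R m n) : Prop :=
  forall (idx : {ffun 'I_m -> 'I_n}) (s : 'S_m), A [ffun k => idx (s k)] = A idx.

Definition rank_one (R : rcfType) (m n : nat) (x : 'I_n -> R) : tensor R m n :=
  fun idx => \prod_(k < m) x (idx k).

Definition completely_decomposable (R : rcfType) (m n : nat) (A : tensor R m n) : Prop :=
  exists (r : nat) (xs : 'I_r -> 'I_n -> R),
    forall idx, A idx = \sum_(j < r) @rank_one R m n (xs j) idx.

(* A polynomial in n variables of degree at most k, given by its coefficients on
   exponent vectors alpha (each exponent <= k), with coefficients vanishing
   whenever the total degree exceeds k. *)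
Definition monomials (n k : nat) := {ffun 'I_n -> 'I_k.+1}.

Definition deg_le (R : rcfType) (n k : nat) (p : monomials n k -> R) : Prop :=
  forall alpha : monomials n k, (k < \sum_(i < n) (alpha i : nat))%N -> p alpha = 0.

Definition peval (R : rcfType) (n k : nat) (p : monomials n k -> R) (x : 'I_n -> R) : R :=
  \sum_(alpha : monomials n k) p alpha * \prod_(i < n) x i ^+ alpha i.

Definition sos_tensor (R : rcfType) (m n : nat) (A : tensor R m n) : Prop :=
  @symmetric_tensor R m n A /\
  exists (r : nat) (ps : 'I_r -> monomials n m./2 -> R),
    (forall j, deg_le (ps j)) /\
    forall x : 'I_n -> R, tapp A x = \sum_(j < r) (peval (ps j) x) ^+ 2.

(* Main.v *)
(* The base field is an arbitrary real closed field, so the representation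
   1/s = \int_0^1 t^(s-1) dt, from which (iv) => (i) is usually deduced, is not
   available.  Instead let C be the Cauchy tensor of c > 0 with d = 1.
   (1) If the form p = \sum_f B_f x^f is nonnegative, then <B, C> >= 0.  Indeed
       <B, C> = q(1) for q = \sum_f B_f/(c_{f 1}+...+c_{f m}) x^f, and
       \sum_i c_i x_i D_i q = p while \sum_i x_i D_i q = m q
       (D_i = d/dx_i).  At a minimizer of q over [0,1]^n each x_i D_i q is <= 0,
       because shrinking a coordinate stays in the cube; p >= 0 then forces all of them to vanish, so the minimum of q is 0.
   (2) The cone of completely decomposable tensors contains its bidual: take the
       point of the cone nearest to C; by Caratheodory boundedly many summands
       suffice, and the first-order conditions together with (1) show that the
       distance is 0.
   Both steps minimize a polynomial over a box.  Over a real closed field the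
   minimizer is obtained from quantifier elimination: bounded definable sets have
   suprema, hence bounded shrinking definable families have cluster points. *)
Require Import Defs.
From HB Require Import structures.
From mathcomp Require Import all_boot all_order all_algebra all_fingroup.
From mathcomp Require Import ring lra.
From mathcomp Require Import polyrcf ordered_qelim.
From mathcomp Require qe_rcf.
Import Order.TTheory GRing.Theory Num.Theory.
Local Open Scope ring_scope.
Set Implicit Arguments. Unset Strict Implicit. Unset Printing Implicit Defensive.

(** * Definable sets over a real closed field and their suprema *)

Section Definable.
Variable R : rcfType.

Definition definable (k : nat) (P : seq R -> Prop) :=
  exists f : ord.formula R,
    forall e, size e = k -> (ord.holds e f <-> P e).

Lemma definable_ext k (P Q : seq R -> Prop) :
  (forall e, size e = k -> (P e <-> Q e)) -> definable k P -> definable k Q.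
Proof.
by move=> PQ [f fP]; exists f => e se; rewrite fP // PQ.
Qed.

Lemma definable_le k (t u : GRing.term R) :
  definable k (fun e => GRing.eval e t <= GRing.eval e u).
Proof. by exists (ord.Le t u). Qed.

Lemma definable_lt k (t u : GRing.term R) :
  definable k (fun e => GRing.eval e t < GRing.eval e u).
Proof. by exists (ord.Lt t u). Qed.

Lemma definable_and k P Q :
  definable k P -> definable k Q -> definable k (fun e => P e /\ Q e).
Proof.
by move=> [f fP] [g gQ]; exists (ord.And f g) => e se /=; rewrite fP ?gQ.
Qed.

Lemma definable_not k P : definable k P -> definable k (fun e => ~ P e).
Proof. by move=> [f fP]; exists (ord.Not f) => e se /=; rewrite fP. Qed.

Lemma definable_all k n (P : nat -> seq R -> Prop) :
  (forall i, definable k (P i)) ->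
  definable k (fun e => forall i, (i < n)%N -> P i e).
Proof.
move=> dP; elim: n => [|n IHn]; first by exists (ord.Bool true).
apply: definable_ext (definable_and IHn (dP n)) => e _; split.
  by move=> [IH Pn] i; rewrite ltnS leq_eqVlt => /predU1P[->|/IH].
by move=> H; split=> [i ltin|]; apply: H => //; apply: ltnW.
Qed.

(** Each quantifier binds variable [k], the first position beyond the environment, where an update
    amounts to appending. *)
Lemma definable_exists k n P : definable (k + n) P ->
  definable k (fun e => exists2 x, size x = n & P (e ++ x)).
Proof.
elim: n k P => [|n IHn] k P.
  rewrite addn0; apply: definable_ext => e _; split=> [Pe|[x /size0nil->]].
    by exists [::]; rewrite ?cats0.
  by rewrite cats0.
rewrite addnS -addSn => /IHn[f fP].
exists (ord.Exists k f) => e se /=.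
have snE y : set_nth 0 e k y = rcons e y.
  by rewrite -se; elim: (e) => //= z s ->.
split=> [[y]|[[|y x]//= [sx] Px]].
  rewrite snE fP ?size_rcons ?se // => -[x sx Px].
  by exists (y :: x); rewrite /= ?sx // -cat_rcons.
by exists y; rewrite snE fP ?size_rcons ?se //; exists x; rewrite ?cat_rcons.
Qed.

(** Quantifier elimination decides satisfaction, so case analysis on [P] needs no classical
    axiom. *)
Lemma definable_dec k P e : definable k P -> size e = k -> P e \/ ~ P e.
Proof.
by move=> [f fP] /fP <-; case: (qe_rcf.rcf_satP e f); [left | right].
Qed.

(* The finite list [s] plays the role of the set of endpoints of [D]. *)
Lemma tame_sup (D : pred R) (s : seq R) (x0 b : R) :
  sorted >%R s ->
  (forall x y, x <= y -> (forall z, z \in s -> ~~ (x <= z <= y)) -> D x = D y) ->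
  D x0 -> (forall x, D x -> x <= b) ->
  exists2 m, forall x, D x -> x <= m & forall w, w < m -> exists2 x, w < x & D x.
Proof.
move=> + + Dx0 Db; elim: s => [|m s IHs] srt tame.
  have := Db (b + 1); rewrite -(tame x0 (b + 1)) //; last first.
    by rewrite (le_trans (Db _ Dx0)) // lerDl.
  by move/(_ Dx0); rewrite leNgt ltrDl ltr01.
have ltsm z : z \in s -> z < m.
  by move: srt; rewrite /= (path_sortedE (rev_trans lt_trans)) => /andP[/allP+ _] => /[apply].
(* [m] is the largest point of the list, so [D] is constant beyond it, and [b] forces that constant
   to be false. *)
have Dm x : m < x -> D x = false.
  move=> ltmx; apply/negP => Dx.
  have bx := Db _ Dx.
  have := Db (b + 1); rewrite -(tame x (b + 1)); last first.
  - move=> z; rewrite inE => /predU1P[->|/ltsm zm]; first by rewrite leNgt ltmx.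
    by rewrite leNgt (lt_trans zm ltmx).
  - by rewrite (le_trans bx) // lerDl.
  by move/(_ Dx); rewrite leNgt ltrDl ltr01.
(* [mid] samples the gap just below [m], where [D] is constant; if [D] holds at [m] or at [mid], the
   supremum is [m]. *)
have [mid ltmid smid] : exists2 mid, mid < m & forall z, z \in s -> z < mid.
  case: s srt {IHs tame ltsm} => [|m' s] /= srt; first by exists (m - 1); rewrite ?gtrBl.
  move: srt => /andP[m'm]; rewrite (path_sortedE (rev_trans lt_trans)) => /andP[/allP sm' _].
  exists ((m' + m) / 2%:R); first lra.
  by move=> z; rewrite inE => /predU1P[->|/sm' /= ?]; lra.
have Dmid x : x < m -> (forall z, z \in s -> z < x) -> D x = D mid.
  move=> xm sx; case: (leP x mid) => [le|/ltW le]; last apply/esym; apply: tame => // z;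
    rewrite inE => /predU1P[->|zs]; rewrite negb_and -!ltNge.
  - by rewrite ltmid orbT.
  - by rewrite sx.
  - by rewrite xm orbT.
  - by rewrite smid.
have ubm x : D x -> x <= m by case: leP => // /Dm->.
have [Dmm|Dmm] := boolP (D m); first by exists m => // w; exists m.
have [Dmd|Dmd] := boolP (D mid).
  exists m => // w wm; exists ((Num.max w mid + m) / 2%:R).
    have : w <= Num.max w mid by rewrite le_max lexx.
    by lra.
  have lm : Num.max w mid < m by rewrite gt_max wm.
  have mm : mid <= Num.max w mid by rewrite le_max lexx orbT.
  rewrite Dmid //; first lra.
  by move=> z /smid; lra.
apply: IHs; first exact: path_sorted srt.
move=> x y xy nos; have [/andP[xm my]|nm] := boolP (x <= m <= y); last first.
  by apply: tame => // z; rewrite inE => /predU1P[->|/nos].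
have -> : D y = false.
  by move: my; rewrite le_eqVlt => /predU1P[<-|/Dm//]; apply/negbTE.
move: xm; rewrite le_eqVlt => /predU1P[->|xm]; first exact/negbTE.
rewrite Dmid //; first exact/negbTE.
move=> z zs; have := nos z zs; rewrite negb_and -!ltNge => /orP[//|yz].
by have := lt_le_trans yz (ltW (ltsm z zs)); rewrite ltNge my.
Qed.

Lemma rterm_poly (t : GRing.term R) :
  GRing.rterm t -> exists p : {poly R}, forall x, GRing.eval [:: x] t = p.[x].
Proof.
elim: t => //=.
- by case=> [|n] _; [exists 'X | exists 0] => x; rewrite ?hornerX ?horner0 /= ?nth_nil.
- by move=> c _; exists c%:P => x; rewrite hornerC.
- by move=> n _; exists (n%:R)%:P => x; rewrite hornerC.
- by move=> t IHt u IHu /andP[/IHt[p pE] /IHu[q qE]]; exists (p + q) => x; rewrite hornerD pE qE.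
- by move=> t IHt /IHt[p pE]; exists (- p) => x; rewrite hornerN pE.
- by move=> t IHt n /IHt[p pE]; exists (p *+ n) => x; rewrite hornerMn pE.
- by move=> t IHt u IHu /andP[/IHt[p pE] /IHu[q qE]]; exists (p * q) => x; rewrite hornerM pE qE.
- by move=> t IHt n /IHt[p pE]; exists (p ^+ n) => x; rewrite horner_exp pE.
Qed.

(** One-variable o-minimality: the finitely many roots of [p] cut the line into pieces on which [D]
    is constant. *)
Definition tame (D : R -> bool) (p : {poly R}) :=
  p != 0 /\ forall x y, x <= y -> (forall z, root p z -> ~~ (x <= z <= y)) -> D x = D y.

Lemma tame_sign (p : {poly R}) : exists2 q, q != 0 &
  forall x y, x <= y -> (forall z, root q z -> ~~ (x <= z <= y)) ->
  Num.sg p.[x] = Num.sg p.[y].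
Proof.
have [->|pn0] := eqVneq p 0; first by exists 1; rewrite ?oner_eq0 // => x y; rewrite !horner0.
exists p => // x y xy nor; have [pxy|pxy] := leP (p.[x] * p.[y]) 0.
  have [z] := polyrcf.poly_ivt xy pxy.
  by rewrite in_itv /= => zxy /nor; rewrite zxy.
 apply/eqP; rewrite -subr_eq0; apply/eqP.
have: Num.sg (p.[x] * p.[y]) = 1 by rewrite gtr0_sg.
by rewrite sgrM; case: (sgrP p.[x]) => _; case: (sgrP p.[y]) => _; lra.
Qed.

(** An atom depends only on the sign of the difference of its sides; for a binary connective the
    product of the two polynomials serves. *)
Lemma qf_tame (f : ord.formula R) : ord.qf_form f -> ord.rformula f ->
  exists p, tame (fun x => ord.qf_eval [:: x] f) p.
Proof.
have atom (t u : GRing.term R) (a : R -> bool) (F : R -> bool) :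
    GRing.rterm t && GRing.rterm u ->
    (forall x, F x = a (Num.sg (GRing.eval [:: x] u - GRing.eval [:: x] t))) ->
    exists p, tame F p.
  move=> /andP[/rterm_poly[p pE] /rterm_poly[q qE]] FE.
  have [r rn0 rP] := tame_sign (q - p); exists r; split=> // x y xy nor.
  by rewrite !FE !pE !qE -!hornerN -!hornerD (rP x y).
have mulT F G H : (exists p, tame F p) -> (exists q, tame G q) ->
    (forall x y, F x = F y -> G x = G y -> H x = H y) -> exists p, tame H p.
  move=> [p [pn0 pP]] [q [qn0 qP]] FGH; exists (p * q); split; first exact: mulf_neq0.
  by move=> x y xy nor; apply: FGH; [apply: pP|apply: qP] => // z rz;
    apply: nor; rewrite rootM rz ?orbT.
elim: f => //=.
- by move=> b _ _; exists 1; split; rewrite ?oner_eq0.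
- move=> t u _ /(atom t u (fun x => x == 0)); apply => x.
  by rewrite sgr_eq0 subr_eq0 eq_sym.
- by move=> t u _ /(atom t u (fun x => x > 0)); apply => x; rewrite sgr_gt0 subr_gt0.
- by move=> t u _ /(atom t u (fun x => x >= 0)); apply => x; rewrite sgr_ge0 subr_ge0.
- by move=> f IHf g IHg /andP[/IHf Hf /IHg Hg] /andP[/Hf tf /Hg tg];
    apply: mulT tf tg _ => x y -> ->.
- by move=> f IHf g IHg /andP[/IHf Hf /IHg Hg] /andP[/Hf tf /Hg tg];
    apply: mulT tf tg _ => x y -> ->.
- by move=> f IHf g IHg /andP[/IHf Hf /IHg Hg] /andP[/Hf tf /Hg tg];
    apply: mulT tf tg _ => x y -> ->.
- by move=> f IHf /IHf Hf /Hf tf; apply: (mulT _ _ _ tf tf) => x y ->.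
Qed.

(** Quantifier elimination makes [P] a quantifier-free, hence tame, condition; its roots in
    decreasing order are the endpoints for [tame_sup]. *)
Lemma definable_sup (P : seq R -> Prop) (x0 b : R) : definable 1 P ->
  P [:: x0] -> (forall x, P [:: x] -> x <= b) ->
  exists2 m, forall x, P [:: x] -> x <= m
           & forall w, w < m -> exists2 x, w < x & P [:: x].
Proof.
move=> [f fP].
pose wproj i bc := qe_rcf.qfr_to_formula (@qe_rcf.wproj R i bc).
pose g := ord.quantifier_elim wproj (ord.to_rform f).
have rf := ord.to_rform_rformula f.
have gP x : reflect (P [:: x]) (ord.qf_eval [:: x] g).
  apply: (equivP (ord.quantifier_elim_rformP _ _ [:: x] rf)).
  - exact: qe_rcf.wf_QE_wproj.
  - exact: qe_rcf.valid_QE_wproj.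
  by rewrite ord.to_rformP fP.
have /andP[qg rg] := ord.quantifier_elim_wf (@qe_rcf.wf_QE_wproj R) rf.
have [p [pn0 pP]] := qf_tame qg rg.
move=> Px0 Pb.
have srt : sorted >%R (rev (rootsR p)) by rewrite rev_sorted; exact: sorted_roots.
have [x y xy nor||x /gP/Pb//|m mP mP'] :=
    @tame_sup (fun x => ord.qf_eval [:: x] g) (rev (rootsR p)) x0 b srt.
- apply: pP => // z rz; apply: nor.
  by rewrite mem_rev -(roots_on_rootsR pn0) ?inE.
- exact/gP.
exists m => [x /gP/mP//|w /mP'[x wx /gP]]; by exists x.
Qed.

End Definable.

(** * Cluster points of definable families and minima of polynomials over a box *)

Section Minimum.
Variable R : rcfType.

Section Cluster.
Variables (N : nat) (M : R).

(** Environments have the form [[:: c, eps & x]]; slot 0 is reserved for the threshold [c] of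
    [cluster_coord]. *)
Definition shrinking (P : R -> seq R -> Prop) :=
  [/\ definable N.+2 (fun e => P e`_1 (drop 2 e)),
      forall eps del x, eps <= del -> P eps x -> P del x,
      forall eps x i, (i < N)%N -> P eps x -> `|x`_i| <= M
    & forall eps, 0 < eps -> exists2 x, size x = N & P eps x].

(** The witness [a] is the lower limit of coordinate [i]: the supremum of all its lower bounds on
    the sets [P del] with [del > 0]. *)
Lemma cluster_coord P i : (i < N)%N -> shrinking P ->
  exists a, forall eps, 0 < eps ->
    exists2 x, size x = N & P eps x /\ `|x`_i - a| <= eps.
Proof.
move=> iN [dP Pmono Pbnd Pne].
pose Q e := P e`_1 (drop 2 e) /\ e`_(i.+2) < e`_0.
pose S e := 0 < e`_1 /\ ~ exists2 x, size x = N & Q (e ++ x).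
have dQ : definable N.+2 Q.
  exact: definable_and dP (definable_lt _ (GRing.Var R i.+2) (GRing.Var R 0)).
have dnQ : definable 2 (fun e => exists2 x, size x = N & Q (e ++ x)).
  exact: (@definable_exists _ 2 N Q).
have dS : definable 2 S.
  apply: definable_and (definable_not dnQ).
  exact: (definable_lt _ (GRing.NatConst R 0) (GRing.Var R 1)).
pose D e := exists2 e1, size e1 = 1 & S (e ++ e1).
have DE c : D [:: c] <-> exists2 del, 0 < del &
    forall x, size x = N -> P del x -> c <= x`_i.
  split=> [[[|del []]//= _ [dpos nQ]]|[del dpos H]].
    exists del => // x sx Px; rewrite leNgt; apply/negP => xc; apply: nQ.
    by exists x; rewrite // /Q /= drop0.
  exists [:: del] => //; split=> // -[x sx]; rewrite /Q /= drop0 => -[Px].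
  by rewrite ltNge H.
have dD : definable 1 D by exact: (@definable_exists _ 1 1).
have [| |a aub alub] := @definable_sup _ D (- M) M dD.
- apply/DE; exists 1 => // x _ Px.
  by have := Pbnd _ _ i iN Px; rewrite ler_norml => /andP[].
- move=> c /DE[del /Pne[x sx Px] H]; apply: le_trans (H _ sx Px) _.
  exact: le_trans (ler_norm _) (Pbnd _ _ i iN Px).
exists a => eps eps0.
have [c ac /DE[del dpos cle]] := alub (a - eps) ltac:(by rewrite gtrBl).
set eta := Num.min eps del.
have eta0 : 0 < eta by rewrite lt_min eps0.
have ee : eta <= eps by rewrite ge_min lexx.
have ed : eta <= del by rewrite ge_min lexx orbT.
(* [a + eps] exceeds the supremum, so it is no lower bound on [P eta]; decidability yields an actual
   point below it. *)
have [[x sx []]|no] := definable_dec dnQ (erefl (size [:: a + eps; eta])); last first.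
  have /aub : D [:: a + eps].
    by apply/DE; exists eta => // x sx Px; rewrite leNgt; apply/negP => xa;
      apply: no; exists x; rewrite // /Q /= drop0.
  by rewrite gerDl leNgt eps0.
rewrite /= drop0 => Px xa; exists x => //; split; first exact: Pmono Px.
have := cle x sx (Pmono _ _ _ ed Px).
by rewrite ler_norml => ?; apply/andP; split; lra.
Qed.

(** Coordinates are fixed one at a time: requiring closeness to the limits already found leaves the
    family shrinking. *)
Lemma cluster P : shrinking P ->
  exists2 a, size a = N & forall eps, 0 < eps ->
    exists2 x, size x = N & P eps x /\ forall i, (i < N)%N -> `|x`_i - a`_i| <= eps.
Proof.
move=> PP; have [dP Pmono Pbnd Pne] := PP.
suff H j : (j <= N)%N -> exists2 a, size a = j & forall eps, 0 < eps ->
    exists2 x, size x = N & P eps x /\ forall i, (i < j)%N -> `|x`_i - a`_i| <= eps.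
  exact: H (leqnn N).
elim: j => [_|j IHj jN].
  by exists [::] => // eps /Pne[x sx Px]; exists x.
have [a sa aP] := IHj (ltnW jN).
pose P' eps x := P eps x /\ forall i, (i < j)%N -> `|x`_i - a`_i| <= eps.
have PP' : shrinking P'.
  split=> [|eps del x ed [Px xa]|eps x i iN [Px _]|//].
  - apply: definable_and (dP) _; apply: definable_all => i.
    pose d := GRing.Add (GRing.Var R i.+2) (GRing.Opp (GRing.Const a`_i)).
    apply: definable_ext (definable_and (definable_le _ d (GRing.Var R 1))
      (definable_le _ (GRing.Opp (GRing.Var R 1)) d)) => e _ /=.
    by rewrite nth_drop ler_norml; split=> [[-> ->]|/andP[]].
  - by split=> [|i /xa]; [apply: Pmono Px|move/le_trans; apply].
  - exact: Pbnd iN Px.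
have [b bP] := cluster_coord jN PP'.
exists (rcons a b); first by rewrite size_rcons sa.
move=> eps /bP[x sx [[Px xa] xb]]; exists x => //; split=> // i.
rewrite nth_rcons sa ltnS leq_eqVlt => /predU1P[->|ij]; first by rewrite ltnn eqxx.
by rewrite ij xa.
Qed.

End Cluster.

(** An inductive closure, so that terms and Lipschitz constants come by induction; [polyfun_ext]
    replaces functional extensionality. *)
Inductive polyfun (T : Type) : ((T -> R) -> R) -> Prop :=
| polyfun_const c : polyfun (fun=> c)
| polyfun_var t : polyfun (fun x => x t)
| polyfun_add F G : polyfun F -> polyfun G -> polyfun (fun x => F x + G x)
| polyfun_mul F G : polyfun F -> polyfun G -> polyfun (fun x => F x * G x)
| polyfun_ext F G : (forall x, F x = G x) -> polyfun F -> polyfun G.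

Lemma polyfun_exp T (F : (T -> R) -> R) n :
  polyfun F -> polyfun (fun x => F x ^+ n).
Proof.
move=> pF; elim: n => [|n IHn].
  by apply: polyfun_ext (polyfun_const T 1) => x; rewrite expr0.
by apply: polyfun_ext (polyfun_mul pF IHn) => x; rewrite exprS.
Qed.

Lemma polyfun_sum T (I : Type) (r : seq I) (F : I -> (T -> R) -> R) :
  (forall i, polyfun (F i)) -> polyfun (fun x => \sum_(i <- r) F i x).
Proof.
move=> pF; elim: r => [|i r IHr].
  by apply: polyfun_ext (polyfun_const T 0) => x; rewrite big_nil.
by apply: polyfun_ext (polyfun_add (pF i) IHr) => x; rewrite big_cons.
Qed.

Lemma polyfun_prod T (I : Type) (r : seq I) (F : I -> (T -> R) -> R) :
  (forall i, polyfun (F i)) -> polyfun (fun x => \prod_(i <- r) F i x).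
Proof.
move=> pF; elim: r => [|i r IHr].
  by apply: polyfun_ext (polyfun_const T 1) => x; rewrite big_nil.
by apply: polyfun_ext (polyfun_mul (pF i) IHr) => x; rewrite big_cons.
Qed.

Lemma polyfun_term T (F : (T -> R) -> R) (s : T -> nat) : polyfun F ->
  exists t, forall (e : seq R) x, (forall i, x i = e`_(s i)) -> GRing.eval e t = F x.
Proof.
elim=> [c|i|{}F G _ [t tP] _ [u uP]|{}F G _ [t tP] _ [u uP]|{}F G FG _ [t tP]].
- by exists (GRing.Const c).
- by exists (GRing.Var R (s i)) => e x xe /=; rewrite xe.
- by exists (GRing.Add t u) => e x xe /=; rewrite (tP e x) ?(uP e x).
- by exists (GRing.Mul t u) => e x xe /=; rewrite (tP e x) ?(uP e x).
- by exists t => e x xe; rewrite -FG (tP e x).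
Qed.

(** The bound and the Lipschitz constant are built together because the product case needs both. *)
Lemma polyfun_lipschitz T (F : (T -> R) -> R) (M : R) : polyfun F ->
  exists B K, [/\ 0 <= B, 0 <= K,
    forall x, (forall i, `|x i| <= M) -> `|F x| <= B
  & forall x y d, (forall i, `|x i| <= M) -> (forall i, `|y i| <= M) ->
      (forall i, `|x i - y i| <= d) -> 0 <= d -> `|F x - F y| <= K * d].
Proof.
elim=> [c|i|{}F G _ [B [K [B0 K0 FB FK]]] _ [B' [K' [B'0 K'0 GB GK]]]
  |{}F G _ [B [K [B0 K0 FB FK]]] _ [B' [K' [B'0 K'0 GB GK]]]|{}F G FG _ [B [K [B0 K0 FB FK]]]].
- exists `|c|, 0; split=> //.
  by move=> x y d _ _ _ _; rewrite subrr normr0 mul0r.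
- exists `|M|, 1; split=> // [x xM|x y d _ _ xy _]; last by rewrite mul1r.
  exact: le_trans (xM i) (ler_norm M).
- exists (B + B'), (K + K'); split=> [||x xM|x y d xM yM xyd d0]; try exact: addr_ge0.
    by rewrite (le_trans (ler_normD _ _)) // lerD ?FB ?GB.
  rewrite mulrDl opprD addrACA (le_trans (ler_normD _ _)) //.
  by rewrite lerD ?FK ?GK.
- exists (B * B'), (K * B' + B * K'); split=> [||x xM|x y d xM yM xyd d0].
  - exact: mulr_ge0.
  - by rewrite addr_ge0 ?mulr_ge0.
  - by rewrite normrM ler_pM ?FB ?GB.
  have -> : F x * G x - F y * G y = (F x - F y) * G x + F y * (G x - G y) by ring.
  rewrite (le_trans (ler_normD _ _)) // !normrM mulrDl lerD //.
    by rewrite mulrAC ler_pM ?FK ?GB.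
  by rewrite -mulrA ler_pM ?FB ?GK.
- exists B, K; split=> // [x xM|x y d xM yM xyd d0]; first by rewrite -FG FB.
  by rewrite -!FG FK.
Qed.

Lemma le_epsilon_mul (a b K : R) : (forall eps, 0 < eps -> a <= b + K * eps) -> a <= b.
Proof.
move=> H; rewrite leNgt; apply/negP => ba.
have K1 : 0 < `|K| + 1 by rewrite ltr_wpDl.
set eps := (a - b) / 2%:R / (`|K| + 1).
have e0 : 0 < eps by rewrite !divr_gt0 ?subr_gt0.
have eE : (`|K| + 1) * eps = (a - b) / 2%:R by rewrite mulrC divfK // gt_eqF.
have : K * eps <= (`|K| + 1) * eps.
  by rewrite ler_wpM2r ?(ltW e0) // (le_trans (ler_norm _)) // lerDl.
by have := H _ e0; lra.
Qed.

(** The points where [F] is within [eps] of its infimum form a shrinking family; a cluster point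
    lies in the box and attains the infimum, as [F] is Lipschitz there. *)
Lemma box_min (T : finType) (F : (T -> R) -> R) (l u : R) : l <= u -> polyfun F ->
  exists2 a : T -> R, (forall i, l <= a i <= u)
    & forall x, (forall i, l <= x i <= u) -> F a <= F x.
Proof.
move=> lu pF; pose N := #|T|.
pose of_seq (x : seq R) (t : T) := x`_(enum_rank t).
pose to_seq (x : T -> R) := [seq x t | t <- enum T].
have szto x : size (to_seq x) = N by rewrite size_map -cardE.
have to_seqK x t : of_seq (to_seq x) t = x t.
  by rewrite /of_seq (nth_map t) ?nth_enum_rank // -cardE.
have [t0 t0P] := polyfun_term (fun t => enum_rank t : nat) pF.
have Fto x : F (of_seq (to_seq x)) = F x.
  by rewrite -(t0P (to_seq x)) // (t0P _ x) // => t; rewrite -[RHS]/(of_seq _ t) to_seqK.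
pose inbox (x : seq R) := forall i, (i < N)%N -> l <= x`_i <= u.
have inboxP x i : inbox x -> l <= of_seq x i <= u by apply; rewrite ltn_ord.
have inbox_to x : (forall i, l <= x i <= u) -> inbox (to_seq x).
  move=> xlu i iN; rewrite (nth_map (enum_val (Ordinal iN))) ?xlu //.
  by rewrite -cardE.
pose M := `|l| + `|u|.
have leM z : l <= z <= u -> `|z| <= M.
  move=> /andP[lz zu]; rewrite ler_norml /M; have := ler_norm u.
  have := ler_norm (- l); have := normr_ge0 l; have := normr_ge0 u.
  by rewrite normrN => *; apply/andP; split; lra.
have [B [K [B0 K0 FB FK]]] := polyfun_lipschitz M pF.
have dbox k : definable (k + N) (fun e => inbox (drop k e)).
  apply: definable_all => i.
  apply: definable_ext (definable_and
     (definable_le _ (GRing.Const l) (GRing.Var R (k + i)))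
     (definable_le _ (GRing.Var R (k + i)) (GRing.Const u))) => e _ /=.
  by rewrite nth_drop; split=> [[-> ->]|/andP[]].
(* [definable_sup] gives suprema, so [W] collects the [v] for which [F] takes a value at most [- v];
   its supremum is minus the infimum. *)
pose W e := exists2 x, size x = N & inbox (drop 1 (e ++ x)) /\
  F (of_seq (drop 1 (e ++ x))) <= - (e ++ x)`_0.
have WE v : W [:: v] <-> exists2 x, size x = N & inbox x /\ F (of_seq x) <= - v.
  by split=> -[x sx]; rewrite /= ?drop0 => H; exists x; rewrite //= drop0.
have dW : definable 1 W.
  have [t tP] := polyfun_term (fun t => (enum_rank t).+1) pF.
  apply: (@definable_exists _ 1 N (fun e => inbox (drop 1 e) /\ F (of_seq (drop 1 e)) <= - e`_0)).
  apply: definable_and (dbox 1) _.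
  apply: definable_ext (definable_le _ t (GRing.Opp (GRing.Var R 0))) => e _ /=.
  by rewrite (tP _ (of_seq (drop 1 e))) // => i; rewrite /of_seq nth_drop.
pose x0 : T -> R := fun=> l.
have x0b i : l <= x0 i <= u by rewrite lexx.
have [|v /WE[x sx [xb Fx]]|s sub slub] := @definable_sup _ W (- F x0) B dW.
- by apply/WE; exists (to_seq x0) => //; split; [apply: inbox_to|rewrite Fto opprK].
- have := FB (of_seq x) (fun i => leM _ (inboxP x i xb)).
  by rewrite ler_norml => /andP[? ?]; lra.
pose P eps x := inbox x /\ F (of_seq x) <= - s + eps.
have PP : shrinking N M P.
  split=> [|eps del x ed [xb Fx]|eps x i iN [xb _]|eps eps0].
  - have [t tP] := polyfun_term (fun t => (enum_rank t).+2) pF.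
    apply: definable_and (dbox 2) _.
    apply: definable_ext (definable_le _ t (GRing.Add (GRing.Const (- s)) (GRing.Var R 1)))
      => e _ /=.
    by rewrite (tP _ (of_seq (drop 2 e))) // => i; rewrite /of_seq nth_drop.
  - by split=> //; apply: le_trans Fx _; rewrite lerD2l.
  - exact/leM/xb.
  - have [|v sv /WE[x sx [xb Fx]]] := slub (s - eps); first by rewrite gtrBl.
    by exists x => //; split=> //; apply: le_trans Fx _; lra.
have [a sa aP] := cluster PP.
have ab : inbox a.
  move=> i iN; apply/andP; split; apply: (@le_epsilon_mul _ _ 1) => eps /aP[x sx [[xb _] xa]];
  have := xb i iN; have := xa i iN; rewrite ler_norml => /andP[? ?] /andP[? ?]; lra.
exists (of_seq a) => [i|x xlu]; first exact: inboxP.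
have Fx : - s <= F x.
  rewrite lerNl; apply: sub; apply/WE; exists (to_seq x) => //.
  by split; [apply: inbox_to|rewrite Fto opprK].
apply: le_trans Fx; apply: (@le_epsilon_mul _ _ (K + 1)) => eps eps0.
have [y sy [[yb Fy] ya]] := aP eps eps0.
have : `|F (of_seq a) - F (of_seq y)| <= K * eps.
  apply: FK => [i|i|i|]; [exact/leM/inboxP|exact/leM/inboxP| |exact: ltW].
  by rewrite distrC ya // ltn_ord.
by rewrite ler_norml mulrDl mul1r => /andP[? ?]; lra.
Qed.

End Minimum.

(** * Pairing a positive semi-definite tensor with a Cauchy tensor *)

Section Positivity.
Variable R : rcfType.

(** Factor [p - p.[b]%:P] as [h * ('X - b%:P)]; the derivative at [b] is [h.[b]]. Were it positive,
    [p] would be smaller just left of [b]. *)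
Lemma deriv_le0_left_min (p : {poly R}) (a b : R) : a < b ->
  (forall s, a <= s <= b -> p.[b] <= p.[s]) -> p^`().[b] <= 0.
Proof.
move=> ab pmin; rewrite leNgt; apply/negP => p'0.
have /factor_theorem[h hE] : root (p - p.[b]%:P) b.
  by rewrite rootE hornerD hornerN hornerC subrr.
have p'E : p^`().[b] = h.[b].
  have -> : p = h * ('X - b%:P) + p.[b]%:P by rewrite -hE subrK.
  by rewrite !derivE !hornerE subrr mulr0 add0r.
rewrite p'E in p'0; have [d d0 dP] := poly_cont b h p'0.
set s := Num.max a (b - d / 2%:R).
have sb : s < b by rewrite gt_max ab gtrBl divr_gt0.
have as_ : a <= s by rewrite le_max lexx.
have sd : b - d / 2%:R <= s by rewrite le_max lexx orbT.
have hs : 0 < h.[s].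
  have sbd : `|s - b| < d by rewrite ltr_norml; apply/andP; split; lra.
  by have := dP s sbd; rewrite ltr_norml => /andP[? _]; lra.
have := pmin s; rewrite as_ (ltW sb) => /(_ isT).
have -> : p.[s] = h.[s] * (s - b) + p.[b].
  by have := congr1 (horner^~ s) hE; rewrite !hornerE => <-; rewrite subrK.
by rewrite -subr_ge0 addrK; apply/negP; rewrite -ltNge nmulr_llt0 ?subr_lt0.
Qed.

Variables (m n : nat).
Notation index := {ffun 'I_m -> 'I_n}.

Lemma rank_oneM (x y : 'I_n -> R) (f : index) :
  rank_one (fun i => x i * y i) f = rank_one x f * rank_one y f.
Proof. exact: big_split. Qed.

Lemma rank_one_scale (s : R) (x : 'I_n -> R) (f : index) :
  rank_one (fun i => s * x i) f = s ^+ m * rank_one x f.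
Proof. by rewrite rank_oneM {1}/rank_one prodr_const card_ord. Qed.

Lemma polyfun_rank_one T (x : 'I_n -> T) (f : index) :
  polyfun (fun y : T -> R => rank_one (y \o x) f).
Proof. by apply: polyfun_prod => k; apply: polyfun_var. Qed.

Definition multiplicity (f : index) (i : 'I_n) : nat := \sum_(k < m) (f k == i).

Lemma sum_multiplicity (V : nmodType) (f : index) (w : 'I_n -> V) :
  \sum_i w i *+ multiplicity f i = \sum_(k < m) w (f k).
Proof.
under eq_bigr do rewrite /multiplicity -sumrMnr.
rewrite exchange_big /=; apply: eq_bigr => k _.
by rewrite (bigD1 (f k)) //= eqxx big1 ?addr0 // => i /negPf; rewrite eq_sym => ->.
Qed.

Lemma rank_one_multiplicity (x : 'I_n -> R) (f : index) :
  rank_one x f = \prod_i x i ^+ multiplicity f i.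
Proof.
under eq_bigr do rewrite /multiplicity -prodrXr.
rewrite exchange_big /=; apply: eq_bigr => k _.
by rewrite (bigD1 (f k)) //= eqxx big1 ?mulr1 // => i /negPf; rewrite eq_sym => ->.
Qed.

(** This is (1) above: Euler's identity, plain and weighted by [c], at a minimizer [a] of [q] over
    the unit cube. *)
Lemma psd_cauchy_pairing (B : tensor R m n) (c : 'I_n -> R) :
  (0 < m)%N -> (forall i, 0 < c i) -> psd_tensor B ->
  0 <= \sum_f B f * (\sum_(k < m) c (f k))^-1.
Proof.
move=> m0 c0 psdB; pose sc (f : index) := \sum_(k < m) c (f k).
have sc0 f : sc f != 0.
  rewrite gt_eqF // /sc (bigD1 (Ordinal m0)) //= ltr_wpDr // sumr_ge0 // => k _.
  exact: ltW.
pose b f := B f * (sc f)^-1.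
pose q (x : 'I_n -> R) := \sum_f b f * rank_one x f.
have pq : polyfun q.
  apply: polyfun_sum => f; apply: polyfun_mul; first exact: polyfun_const.
  exact: (polyfun_rank_one (fun i => i)).
have [a aP amin] := box_min (@ler01 R) pq.
have q1 : \sum_f B f * (\sum_(k < m) c (f k))^-1 = q (fun=> 1).
  by rewrite /q; apply: eq_bigr => f _; rewrite [in RHS]/rank_one big1_eq mulr1.
rewrite q1 leNgt; apply/negP => q1neg.
have qa : q a < 0 by apply: le_lt_trans (amin _ _) q1neg => i; rewrite ler01 lexx.
(* [a i] times the [i]-th partial derivative of [q] at [a], that is, the derivative at [s = 1] of
   [q] with coordinate [i] of [a] scaled by [s]. *)
pose D i := \sum_f b f * rank_one a f *+ multiplicity f i.
have D0 i : D i <= 0.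
  pose g := \sum_f (b f * rank_one a f) *: 'X^(multiplicity f i).
  have gE s : g.[s] = q (fun j => (if j == i then s else 1) * a j).
    rewrite /q horner_sum; apply: eq_bigr => f _; rewrite hornerZ hornerXn -mulrA.
    rewrite rank_oneM (rank_one_multiplicity (fun j => if j == i then s else 1)).
    rewrite (bigD1 i) //= eqxx big1 ?mulr1 => [|j /negPf->]; last by rewrite expr1n.
    by rewrite [_ * s ^+ _]mulrC.
  have -> : D i = g^`().[1].
    rewrite /g raddf_sum horner_sum; apply: eq_bigr => f _.
    by rewrite /= derivZ derivXn hornerZ hornerMn hornerXn expr1n mulr_natr.
  apply: (deriv_le0_left_min ltr01) => s /andP[s0 s1].
  have -> : g.[1] = q a.
    rewrite gE /q; apply: eq_bigr => f _; congr (_ * _); apply: eq_bigr => k _.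
    by rewrite if_same mul1r.
  rewrite gE; apply: amin => j; have /andP[aj0 aj1] := aP j.
  by case: (j == i); rewrite ?mul1r ?aj0 // mulr_ge0 //= mulr_ile1.
have sumD : \sum_i D i = q a *+ m.
  rewrite exchange_big /q -sumrMnl; apply: eq_bigr => f _ /=.
  by rewrite (sum_multiplicity f (fun=> _)) sumr_const card_ord.
(* The weights [c] turn each multiplicity sum into [sc f], which cancels the denominator in
   [b f]. *)
have sumcD : \sum_i c i * D i = tapp B a.
  under eq_bigr do rewrite mulr_sumr.
  rewrite exchange_big; apply: eq_bigr => f _ /=.
  under eq_bigr do rewrite mulrnAr mulrC -mulrnAr.
  by rewrite -mulr_sumr sum_multiplicity mulrAC /b mulrVK ?unitfE.
have cD0 i : c i * D i <= 0 by rewrite pmulr_rle0.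
(* Nonpositive terms [c i * D i] with the nonnegative sum [tapp B a] must all vanish; by [sumD] this
   contradicts [qa]. *)
have Dz i : D i = 0.
  have : \sum_i - (c i * D i) == 0.
    rewrite eq_le sumrN sumcD oppr_le0 psdB -sumcD oppr_ge0.
    by rewrite sumr_le0.
  rewrite psumr_eq0; last by move=> j _; rewrite oppr_ge0.
  by move=> /allP/(_ i (mem_index_enum _)); rewrite oppr_eq0 mulf_eq0 (gt_eqF (c0 i)) => /eqP.
move: qa; rewrite -(pmulrn_llt0 _ m0) -sumD big1 ?ltxx //.
Qed.

End Positivity.

(** * Nearest points in the cone of completely decomposable tensors *)

Section Cone.
Variable R : rcfType.

(** Intermediate values on [[0, 1 + w]], as [1 + w <= (1 + w) ^+ m]. The sigma type lets roots be
    picked for a whole family. *)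
Lemma root_exists (w : R) m : (0 < m)%N -> 0 <= w -> {u | u ^+ m = w}.
Proof.
move=> m0 w0; pose p : {poly R} := 'X^m - w%:P.
have w1 : 0 <= 1 + w by rewrite addr_ge0.
have [|x _] := @polyrcf.poly_ivt R p 0 (1 + w) w1.
  rewrite !hornerE expr0n gtn_eqF // sub0r mulNr oppr_le0 mulr_ge0 // subr_ge0.
  rewrite (@le_trans _ _ (1 + w)) ?lerDr // -{1}[1 + w]expr1 ler_weXn2l //.
  by rewrite lerDl.
by rewrite rootE !hornerE subr_eq0 => /eqP; exists x.
Qed.

Lemma lin_dep (I : finType) (v : 'I_#|I|.+1 -> I -> R) :
  exists2 a : 'I_#|I|.+1 -> R, exists j, a j != 0 &
    forall i, \sum_j a j * v j i = 0.
Proof.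
pose A := \matrix_(j < #|I|.+1, k < #|I|) v j (enum_val k).
have /rowV0Pn[a /sub_kermxP aA /rV0Pn[j aj]] : kermx A != 0.
  by rewrite -mxrank_eq0 mxrank_ker -lt0n subn_gt0 ltnS rank_leq_col.
exists (a 0); first by exists j.
move=> i; have := congr1 (fun M : 'rV_ _ => M 0 (enum_rank i)) aA.
by rewrite !mxE => aAi; rewrite -[RHS]aAi; apply: eq_bigr => k _; rewrite mxE enum_rankK.
Qed.

(** From the coefficients 1 subtract a linear relation divided by its largest, positive coefficient:
    none becomes negative, and the one at the maximum becomes 0. *)
Lemma caratheodory (I : finType) (v : 'I_#|I|.+1 -> I -> R) :
  exists w : 'I_#|I|.+1 -> R, [/\ forall j, 0 <= w j, exists j, w j = 0 &
    forall i, \sum_j w j * v j i = \sum_j v j i].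
Proof.
suff [a [j aj] av] : exists2 a : 'I_#|I|.+1 -> R, exists j, 0 < a j &
    forall i, \sum_j a j * v j i = 0.
  have [j0 _ j0P] := @arg_maxP _ _ _ j xpredT a isT.
  have aj0 : 0 < a j0 by apply: lt_le_trans aj (j0P _ isT).
  exists (fun k => 1 - a k / a j0); split.
  - by move=> k; rewrite subr_ge0 ler_pdivrMr // mul1r; apply: j0P.
  - by exists j0; rewrite divff ?subrr // gt_eqF.
  move=> i; under eq_bigr do rewrite mulrBl mul1r mulrAC.
  by rewrite sumrB -mulr_suml av mul0r subr0.
have [a [j aj] av] := lin_dep v.
have [a0|a0] := ltP 0 (a j); first by exists a => //; exists j.
exists (fun k => - a k); first by exists j; rewrite oppr_gt0 lt_neqAle aj.
by move=> i; under eq_bigr do rewrite mulNr; rewrite sumrN av oppr0.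
Qed.

(** A negative [b] would dominate for small [e]; the chosen [e] keeps [s * e] at most [- b / 2]. *)
Lemma ge0_first_order (b s : R) :
  (forall e, 0 < e <= 1 -> 0 <= b * e + s * e ^+ 2) -> 0 <= b.
Proof.
move=> H; rewrite leNgt; apply/negP => b0.
have s1 : 0 < `|s| + 1 by rewrite ltr_wpDl.
pose e := Num.min 1 (- b / 2%:R / (`|s| + 1)).
have e0 : 0 < e by rewrite lt_min ltr01 !divr_gt0 ?oppr_gt0.
have e1 : e <= 1 by rewrite ge_min lexx.
have := H e; rewrite e0 e1 => /(_ isT); rewrite expr2 mulrA -mulrDl.
rewrite pmulr_lge0 // => bse.
have : s * e <= (`|s| + 1) * e.
  by rewrite ler_wpM2r ?(ltW e0) // (le_trans (ler_norm _)) // lerDl.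
have : (`|s| + 1) * e <= - b / 2%:R.
  by rewrite mulrC -ler_pdivlMr // ge_min lexx orbT.
by lra.
Qed.

Variables (m n : nat).
Notation index := {ffun 'I_m -> 'I_n}.

(* [\sum_j (xs j)^m] is a point of the cone nearest to [C].  Its number of
   summands exceeds the dimension of the tensor space by one, so one summand can
   be freed to test a new direction. *)
Lemma completely_decomposable_bidual (C : tensor R m n) :
  (0 < m)%N -> ~~ odd m ->
  (forall B, psd_tensor B -> 0 <= \sum_f B f * C f) ->
  completely_decomposable C.
Proof.
move=> m0 mev bidual.
pose r := #|{: index}|.+1.
pose S (xs : 'I_r -> 'I_n -> R) (f : index) := \sum_j rank_one (xs j) f.
pose Phi xs := \sum_f (C f - S xs f) ^+ 2.
suff [xs xsmin] : exists xs, forall ys, Phi xs <= Phi ys.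
  pose B f := C f - S xs f.
  pose dotB T := \sum_f B f * T f.
  (* Moving by [e * T] changes [Phi] by [- 2 e <B, T> + e^2 |T|^2], which minimality keeps
     nonnegative. *)
  have firstorder (T : tensor R m n) :
      (forall e, 0 < e <= 1 -> exists ys, forall f, S ys f = S xs f + e * T f) ->
      dotB T <= 0.
    move=> H; suff : 0 <= - dotB T *+ 2.
      by rewrite pmulrn_lge0 // oppr_ge0.
    apply: (@ge0_first_order _ (\sum_f T f ^+ 2)) => e /H[ys ysE].
    have := xsmin ys; rewrite -subr_ge0 -sumrB; congr (0 <= _).
    rewrite mulNrn mulNr /dotB -sumrMnl !mulr_suml -sumrN -big_split.
    by apply: eq_bigr => f _ /=; rewrite ysE /B; ring.
  have psdNB : psd_tensor (fun f => - B f).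
    (* Reweighting by [w] empties slot [j0], which then receives [e] times the power of [y]; [m]-th
       roots absorb the weights into the vectors. *)
    move=> y; have [w [w0 [j0 wj0] wE]] := caratheodory (fun j => rank_one (xs j)).
    pose u j := sval (root_exists m0 (w0 j)).
    have uE j : u j ^+ m = w j := svalP (root_exists m0 (w0 j)).
    rewrite /tapp; under eq_bigr do rewrite mulNr.
    rewrite sumrN oppr_ge0; apply: firstorder => e /andP[e0 _].
    have [t tE] := root_exists m0 (ltW e0).
    exists (fun j => if j == j0 then fun i => t * y i else fun i => u j * xs j i) => f.
    rewrite [in RHS]/S -(wE f) [in RHS](bigD1 j0) //= wj0 mul0r add0r.
    rewrite /S (bigD1 j0) //= eqxx rank_one_scale tE addrC.
    by congr (_ + _); apply: eq_bigr => j /negPf->; rewrite rank_one_scale uE.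
  have dotS : 0 <= dotB (S xs).
    rewrite -oppr_le0; have -> : - dotB (S xs) = dotB (fun f => - S xs f).
      by rewrite /dotB -sumrN; apply: eq_bigr => f _; rewrite mulrN.
    (* Scaling every vector by an [m]-th root of [1 - e] moves in the direction [- S xs]. *)
    apply: firstorder => e /andP[e0 e1].
    have e1' : 0 <= 1 - e by rewrite subr_ge0.
    have [u uE] := root_exists m0 e1'.
    exists (fun j i => u * xs j i) => f.
    rewrite /S; under eq_bigr do rewrite rank_one_scale.
    by rewrite -mulr_sumr uE; ring.
  have : \sum_f B f ^+ 2 == 0.
    rewrite eq_le sumr_ge0 ?andbT => [|f _]; last exact: sqr_ge0.
    (* [|B|^2 = <B, C> - <B, S xs>]; [bidual] applied to [- B] makes the first pairing
       nonpositive. *)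
    have -> : \sum_f B f ^+ 2 = - (\sum_f - B f * C f) - dotB (S xs).
      by rewrite -sumrN -sumrB; apply: eq_bigr => f _; rewrite /B; ring.
    by rewrite -opprD oppr_le0 addr_ge0 // bidual.
  rewrite psumr_eq0 => [/allP B0|f _]; last exact: sqr_ge0.
  exists r, xs => f; apply/eqP; rewrite -subr_eq0.
  by have := B0 f (mem_index_enum _); rewrite expf_eq0.
pose cur (x : 'I_r * 'I_n -> R) (j : 'I_r) (i : 'I_n) := x (j, i).
have pPhi : polyfun (fun x => Phi (cur x)).
  apply: polyfun_sum => f; apply: polyfun_exp.
  apply: polyfun_add; first exact: polyfun_const.
  have pS : polyfun (fun x => S (cur x) f).
    by apply: polyfun_sum => j; exact: (polyfun_rank_one R (fun i => (j, i)) f).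
  by apply: polyfun_ext (polyfun_mul (polyfun_const _ (-1)) pS) => x; rewrite mulN1r.
pose z : 'I_r -> 'I_n -> R := fun=> fun=> 0.
(* Large enough that a family with an entry beyond [M] in absolute value does worse than the zero
   family [z]. *)
pose M := 1 + (\sum_f `|C f| + Phi z).
have C0 : 0 <= \sum_f `|C f| by rewrite sumr_ge0.
have Phi0 ys : 0 <= Phi ys by rewrite sumr_ge0 // => f _; rewrite sqr_ge0.
have M1 : 1 <= M by rewrite lerDl addr_ge0.
have M0 : 0 <= M := le_trans ler01 M1.
have [|a aM amin] := box_min (l := - M) (u := M) _ pPhi; first by rewrite (le_trans _ M0) ?oppr_le0.
exists (cur a) => ys; pose y (p : 'I_r * 'I_n) := ys p.1 p.2.
have [/forallP yM|] := boolP [forall p, `|y p| <= M].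
  by apply: (amin y) => p; rewrite -ler_norml.
rewrite negb_forall => /existsP[[j i]]; rewrite -ltNge /y /= => yM.
apply: le_trans (_ : Phi z <= _).
  by apply: (amin (fun=> 0)) => p; rewrite oppr_le0 M0.
rewrite leNgt; apply/negP => small.
(* At a diagonal entry all summands are even powers, so nothing cancels the large one. *)
pose f0 : index := [ffun=> i].
have ev x : 0 <= x ^+ m :> R by rewrite exprn_even_ge0.
have roi x : rank_one x f0 = x i ^+ m.
  by rewrite /rank_one; under eq_bigr do rewrite ffunE; rewrite prodr_const card_ord.
have S1 : `|ys j i| ^+ m <= S ys f0.
  rewrite /S (bigD1 j) //= roi -normrX ger0_norm // lerDl sumr_ge0 // => k _.
  by rewrite roi.
have S2 : (C f0 - S ys f0) ^+ 2 <= Phi z.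
  apply: le_trans (ltW small); rewrite /Phi (bigD1 f0) //= lerDl sumr_ge0 // => f _.
  exact: sqr_ge0.
have S3 : `|C f0| <= \sum_f `|C f| by rewrite (bigD1 f0) //= lerDl sumr_ge0.
have S5 : M < `|ys j i| ^+ m.
  rewrite (lt_le_trans yM) // -{1}[`|ys j i|]expr1 ler_weXn2l //.
  exact: le_trans M1 (ltW yM).
have S6 : 1 + Phi z < S ys f0 - C f0.
  rewrite ltrBrDr; apply: le_lt_trans (lt_le_trans S5 S1).
  by have := ler_norm (C f0); rewrite /M; lra.
have : (S ys f0 - C f0) * 1 <= (C f0 - S ys f0) ^+ 2.
  have S7 : 1 <= S ys f0 - C f0 by rewrite (le_trans _ (ltW S6)) // lerDl.
  by rewrite -sqrrN opprB expr2 ler_wpM2l // (le_trans ler01 S7).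
by move: S2 S6; lra.
Qed.

End Cone.

(** * Powers of linear forms as sums of squares, and values at unit vectors *)

Section SumsOfSquares.
Variable R : rcfType.

Lemma sum_rank_one m n (x : 'I_n -> R) :
  \sum_(f : {ffun 'I_m -> 'I_n}) rank_one x f = (\sum_i x i) ^+ m.
Proof.
by rewrite -(bigA_distr_bigA (fun _ : 'I_m => x)) /= prodr_const card_ord.
Qed.

Lemma leq_multiplicity m n (f : {ffun 'I_m -> 'I_n}) i : (multiplicity f i <= m)%N.
Proof.
rewrite -[leqRHS]card_ord -sum1_card; apply: leq_sum => k _; exact: leq_b1.
Qed.

Section LinearFormPower.
Variables (k n : nat).

Definition exponents (f : {ffun 'I_k -> 'I_n}) : monomials n k :=
  [ffun i => inord (multiplicity f i)].

Lemma exponentsE f i : exponents f i = multiplicity f i :> nat.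
Proof. by rewrite ffunE inordK // ltnS leq_multiplicity. Qed.

Lemma sum_exponents f : (\sum_i exponents f i)%N = k.
Proof.
under eq_bigr do rewrite exponentsE.
rewrite exchange_big /=; under eq_bigr => j _.
  rewrite (bigD1 (f j)) //= eqxx big1 => [|i /negPf]; last by rewrite eq_sym => ->.
  over.
by rewrite sum1_card card_ord.
Qed.

(** Coefficients of the [k]-th power of the linear form [a]; the number of [f] in the sum is the
    multinomial coefficient. *)
Definition power_coef (a : 'I_n -> R) (alpha : monomials n k) : R :=
  \sum_(f | exponents f == alpha) rank_one a f.

Lemma power_coef_deg a : deg_le (power_coef a).
Proof.
move=> alpha; apply: contraTeq.
case: (pickP (fun f => exponents f == alpha)) => [f /eqP<- _|no].
  by rewrite sum_exponents ltnn.
by rewrite /power_coef big_pred0 ?eqxx.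
Qed.

Lemma peval_power_coef a x :
  peval (power_coef a) x = (\sum_i a i * x i) ^+ k.
Proof.
rewrite -sum_rank_one (partition_big exponents xpredT) //=.
apply: eq_bigr => alpha _; rewrite mulr_suml; apply: eq_bigr => f /eqP <-.
rewrite rank_oneM (rank_one_multiplicity x); congr (_ * _).
by apply: eq_bigr => i _; rewrite exponentsE.
Qed.

End LinearFormPower.

(** Each summand gives an even power of a linear form, the square of its [m./2]-th power; symmetry
    is commutativity of the product. *)
Lemma completely_decomposable_sos m n (A : tensor R m n) : ~~ odd m ->
  completely_decomposable A -> sos_tensor A.
Proof.
move=> mev [r [xs AE]]; split=> [f s|].
  rewrite !AE; apply: eq_bigr => j _.
  rewrite /rank_one [RHS](reindex_inj (@perm_inj _ s)).
  by apply: eq_bigr => k _; rewrite ffunE.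
exists r, (fun j => power_coef (xs j)); split=> [j|x]; first exact: power_coef_deg.
rewrite /tapp; under eq_bigr => f _ do rewrite AE mulr_suml.
rewrite exchange_big; apply: eq_bigr => j _ /=.
rewrite peval_power_coef -exprM muln2 even_halfK // -sum_rank_one.
by apply: eq_bigr => f _; rewrite rank_oneM.
Qed.

Lemma psd_sos m n (A : tensor R m n) : sos_tensor A -> psd_tensor A.
Proof.
move=> [_ [r [ps [_ AE]]]] x; rewrite AE sumr_ge0 // => j _; exact: sqr_ge0.
Qed.

Lemma tapp_unit m n (A : tensor R m n) (i : 'I_n) :
  tapp A (fun j => (j == i)%:R) = A [ffun=> i].
Proof.
rewrite /tapp (bigD1 [ffun=> i]) //= big1 ?mulr1 => [|k _]; last by rewrite ffunE eqxx.
rewrite big1 ?addr0 // => f; have [/forallP fi|] := boolP [forall k, f k == i].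
  by case/eqP; apply/ffunP => k; rewrite ffunE; apply/eqP.
rewrite negb_forall => /existsP[k /negPf fk] _.
by rewrite (bigD1 k) //= fk mul0r mulr0.
Qed.

End SumsOfSquares.

Theorem theorem3p1 (R : rcfType) (m n : nat) (c d : 'I_n -> R) :
  (2 <= m)%N -> ~~ odd m -> (2 <= n)%N ->
  (forall i, d i != 0) ->
  (forall idx : {ffun 'I_m -> 'I_n}, \sum_(k < m) c (idx k) != 0) ->
  [<-> completely_decomposable (@cauchy_tensor R m n c d);
       sos_tensor (@cauchy_tensor R m n c d);
       psd_tensor (@cauchy_tensor R m n c d);
       forall i, 0 < c i].
Proof.
move=> m2 mev _ dn0 cn0; have m0 : (0 < m)%N by apply: ltnW.
tfae.
- exact: completely_decomposable_sos.
- exact: psd_sos.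
(* The form at the [i]-th unit vector is [d i ^+ m / (c i *+ m)], whose numerator is positive
   because [m] is even. *)
- move=> psdC i; have := psdC (fun j => (j == i)%:R); rewrite tapp_unit.
  have sumE : \sum_(k < m) c ([ffun=> i] k) = c i *+ m.
    by under eq_bigr do rewrite ffunE; rewrite sumr_const card_ord.
  have prodE : \prod_(k < m) d ([ffun=> i] k) = d i ^+ m.
    by under eq_bigr do rewrite ffunE; rewrite prodr_const card_ord.
  have := cn0 [ffun=> i]; rewrite /cauchy_tensor sumE prodE => cm0.
  have dm0 : 0 < d i ^+ m by rewrite lt_neqAle eq_sym expf_neq0 ?exprn_even_ge0.
  rewrite pmulr_rge0 // invr_ge0 => cm.
  by rewrite -(pmulrn_lgt0 _ m0) lt_neqAle eq_sym cm0.
- move=> c0.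
  (* It suffices to decompose the tensor with [d = 1]: the factors [d] are absorbed into the
     vectors. *)
  have [|r [xs xsE]] := @completely_decomposable_bidual R m n
      (fun f => (\sum_(k < m) c (f k))^-1) m0 mev.
    by move=> B psdB; apply: psd_cauchy_pairing.
  exists r, (fun j i => d i * xs j i) => f.
  rewrite /cauchy_tensor xsE mulr_sumr; apply: eq_bigr => j _.
  by rewrite rank_oneM.
Qed.
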